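(* For every collection of multipliers $\boldsymbol{\lambda}=(\lambda_t)_{t=1}^T$ with $\lambda_t:\mathcal{V}_t\to\mathbb{R}$, the Lagrangian recursion decouples as follows. For every $t=1,\ldots,T$ and every $(\mathbf{x}_t,v_t)$, where $\mathbf{x}_t\in\mathcal{X}_t$ has demand component $D_t$, $$L_t(\mathbf{x}_t,v_t;\boldsymbol{\lambda})=\sum_{i=1}^n L_t^i(x_t^i,v_t;\boldsymbol{\lambda})-\sum_{r=t}^T \mathbb{E}\left[\lambda_r(v_r)D_r\,\vert\, v_t\right],$$ where $L_{T+1}^i(x_{T+1}^i,v_{T+1};\boldsymbol{\lambda})=0$ and, for $t=T,\ldots,1$, $$L_t^i(x_t^i,v_t;\boldsymbol{\lambda})=\min_{a_t^i\in\mathcal{A}_t^i(x_t^i)}\mathbb{E}\left[g_t^i(x_t^i,a_t^i)+\lambda_t(v_t)z_t^i+L_{t+1}^i(x_{t+1}^i,v_{t+1};\boldsymbol{\lambda})\,\vert\, x_t^i,v_t,a_t^i\right].$$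
   Context: There are $n$ generators and $T$ periods. Demand. $D_1=0$. For each $t$, $D_t$ takes values in a finite set $\mathcal{D}_t\subset\mathbb{R}$ (with $\mathcal{D}_1=\{0\}$). $(D_t)$ is a Markov process with $P_t(w\vert d)$ the probability that $D_{t+1}=w$ given $D_t=d$. All terminal (period $T+1$) functions are zero, so $D_{T+1}$ plays no role. States. Generator $i$ has minimum up time $\overline{l}_i\ge1$ and minimum down time $\underline{l}_i\ge1$ (integers), production bounds $b^i_{\min}\le b^i_{\max}$, and ramp up/down amounts $r^i_u,r^i_d$. Its state is $x_t^i=(y_t^i,q_t^i,D_t)$. Here $y_t^i=(\alpha_t^i,\beta_t^i)$ with $\alpha^i_t\in\{0,\ldots,\overline{l}_i\}$, $\beta^i_t\in\{0,\ldots,\underline{l}_i\}$, exactly one of them zero (periods on/off, capped), and $q_t^i\in\{0\}\cup[b^i_{\min},b^i_{\max}]$ is the previous production level. The set of such states is $\mathcal{X}_t^i$ for $t\ge2$, and $\mathcal{X}_1^i=\{((0,\underline{l}_i),0,0)\}$. The overall state is $\mathbf{x}_t=(x_t^1,\ldots,x_t^n)\in\mathcal{X}_t$, where $\mathcal{X}_t$ consists of tuples with $x_t^i\in\mathcal{X}_t^i$ sharing a common demand component $D_t$. Actions. The action of generator $i$ is $a_t^i=(z_t^i,u_t^i)$, with production $z_t^i\in\mathbb{R}$ for period $t$ and commitment $u_t^i\in\{0,1\}$ for period $t+1$. Let $\underline{u}(y)=1$ if $y=(j,0)$ with $1\le j\le\overline{l}_i$, and $0$ otherwise. Let $\overline{w}(y)=1$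 if $y=(1,0)$, and $0$ otherwise. Let $\underline{I}(y)=1$ if $y=(j,0)$ with $1\le j\le\overline{l}_i-1$, and $0$ otherwise. Let $\overline{I}(y)=0$ if $y=(0,j)$ with $1\le j\le\underline{l}_i-1$, and $1$ otherwise. Then $\mathcal{A}_t^i(x_t^i)$ is the set of $(z_t^i,u_t^i)$ with $u_t^i\in\{0,1\}$ satisfying $\underline{u}(y_t^i)b^i_{\min}\le z_t^i\le\underline{u}(y_t^i)b^i_{\max}$; $\underline{I}(y_t^i)\le u_t^i\le\overline{I}(y_t^i)$; $q_t^i-r_d^i-(1-\underline{u}(y_t^i))b^i_{\min}\le z_t^i\le q_t^i+r_u^i+\overline{w}(y_t^i)b^i_{\min}$. Put $\mathcal{A}_t(\mathbf{x}_t)=\times_{i=1}^n\mathcal{A}_t^i(x_t^i)$ (demand constraint relaxed). A minimum over an empty set is $+\infty$. Dynamics. $q_{t+1}^i=z_t^i$, and $y_{t+1}^i$ equals $(\alpha_t^i+1,0)$ if $0<\alpha_t^i<\overline{l}_i$; $(0,\beta_t^i+1)$ if $0<\beta_t^i<\underline{l}_i$; $(\overline{l}_i,0)$ if $\alpha_t^i=\overline{l}_i,u_t^i=1$; $(0,1)$ if $\alpha_t^i=\overline{l}_i,u_t^i=0$; $(0,\underline{l}_i)$ if $\beta_t^i=\underline{l}_i,u_t^i=0$; $(1,0)$ if $\beta_t^i=\underline{l}_i,u_t^i=1$. The demand component of the next state is $D_{t+1}\sim P_t(\cdot\vert D_t)$. Costs. With real constants $\bar c_i$ (no-load cost), $h_i$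 (start-up cost) and a real-valued generation cost $F_t^i$ on $\{0\}\cup[b^i_{\min},b^i_{\max}]$, continuous piecewise linear on $[b^i_{\min},b^i_{\max}]$, set $g_t^i(x_t^i,a_t^i)=H_t^i(y_t^i,u_t^i)+\bar c_iu_t^i+F_t^i(z_t^i)$ for $t\le T-1$, where $H_t^i(y,u)=h_i$ if $y=(0,\underline{l}_i),u=1$ and $0$ otherwise; and $g_T^i(x_T^i,a_T^i)=F_T^i(z_T^i)$. Put $g_t(\mathbf{x}_t,\mathbf{a}_t)=\sum_{i=1}^n g_t^i(x_t^i,a_t^i)$. Summary state. $v_1=0$ and $v_t=\tilde f_t(v_{t-1},D_t)$ for $t\ge2$, for given functions $\tilde f_t$; $v_t$ lies in a finite set $\mathcal{V}_t$. Standing assumption: for all $r>t$, the conditional distribution of $D_r$ given $D_1,\ldots,D_t$ depends only on $v_t$. Pairs $(\mathbf{x}_t,v_t)$ are understood to be consistent: the pair (demand component of $\mathbf{x}_t$, $v_t$) is a value of $(D_t,v_t)$ having positive probability. Lagrangian recursion. $L_{T+1}(\mathbf{x}_{T+1},v_{T+1};\boldsymbol{\lambda})=0$ and, for $t=T,\ldots,1$, $$L_t(\mathbf{x}_t,v_t;\boldsymbol{\lambda})=\min_{\mathbf{a}_t\in\mathcal{A}_t(\mathbf{x}_t)}\mathbb{E}\Big[g_t(\mathbf{x}_t,\mathbf{a}_t)+\lambda_t(v_t)\Big(\sum_{i=1}^n z_t^i-D_t\Big)+L_{t+1}(\mathbf{x}_{t+1},v_{t+1};\boldsymbol{\lambda})\,\Big\vert\,\mathbf{x}_t,v_t,\mathbf{a}_t\Big],$$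 where the expectation is over $D_{t+1}\sim P_t(\cdot\vert D_t)$. Notation. $\mathbb{E}[\lambda_r(v_r)D_r\,\vert\,v_t]$ for $1\le t\le r\le T$ is the expected value of $\lambda_r(v_r)D_r$ given that the summary state in stage $t$ is $v_t$, over the random outcomes $D_{t+1},\ldots,D_r$; for $r=t$ it is simply $\lambda_t(v_t)D_t$. *)

(* Defs.v *)
From HB Require Import structures.
From mathcomp Require Import all_boot all_order all_algebra finmap.
From mathcomp Require Import all_classical all_reals all_analysis.
Set Implicit Arguments.
Unset Strict Implicit.
Unset Printing Implicit Defensive.
Import Order.TTheory GRing.Theory Num.Theory.
Import numFieldNormedType.Exports.
Local Open Scope classical_set_scope.
Local Open Scope ring_scope.

(* Minimum in the extended reals, with the convention min(empty) = +oo. *)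
Definition is_emin (R : realType) (S : set (\bar R)) (m : \bar R) : Prop :=
  (S = set0 /\ m = +oo%E) \/ (S m /\ lbound S m).

(* The breakpoints are a < s_0 < ... < last = b; s is empty when a = b. *)
Definition piecewise_linear (R : realType) (a b : R) (F : R -> R) : Prop :=
  exists s : seq R, [/\ path <%R a s, last a s = b &
    forall j, (j < size s)%N -> exists m c : R, forall z,
      nth a (a :: s) j <= z <= nth a s j -> F z = m * z + c].

Record generator (R : realType) := Generator {
  min_up : nat;
  min_down : nat;
  bmin : R;
  bmax : R;
  ramp_up : R;
  ramp_down : R;
  noload_cost : R;
  startup_cost : R;
  gen_cost : nat -> R -> R (* F_t *)
}.

(* (alpha, beta): numbers of periods on and off, one of them being zero *)
Definition onoff := (nat * nat)%type.

Record gstate (R : realType) := GState {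
  g_onoff : onoff;
  g_prod : R;
  g_demand : R
}.

Record gaction (R : realType) := GAction {
  a_prod : R;
  a_commit : bool
}.

(* A tuple of generator states sharing one demand component is stored as the
   common demand together with the remaining components of each generator. *)
Record sstate (R : realType) (n : nat) := SState {
  s_onoff : 'I_n -> onoff;
  s_prod : 'I_n -> R;
  s_demand : R
}.

Definition scomp (R : realType) (n : nat) (x : sstate R n) (i : 'I_n) :
    gstate R :=
  GState (s_onoff x i) (s_prod x i) (s_demand x).

Section Generator.
Variables (R : realType) (G : generator R).
Implicit Types (y : onoff) (x : gstate R) (a : gaction R).

Definition is_on y : bool := (1 <= y.1 <= min_up G)%N && (y.2 == 0%N).
Definition just_started y : bool := y == (1%N, 0%N).
Definition must_stay_on y : bool :=
  (1 <= y.1 <= (min_up G).-1)%N && (y.2 == 0%N).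
Definition may_be_on y : bool :=
  ~~ ((y.1 == 0%N) && (1 <= y.2 <= (min_down G).-1)%N).

Definition onoff_ok y : Prop :=
  [/\ (y.1 <= min_up G)%N, (y.2 <= min_down G)%N
    & (y.1 == 0%N) != (y.2 == 0%N)].

Definition gaction_set x : set (gaction R) := [set a |
  [/\ (is_on (g_onoff x))%:R * bmin G <= a_prod a
        <= (is_on (g_onoff x))%:R * bmax G,
      (must_stay_on (g_onoff x) <= a_commit a <= may_be_on (g_onoff x))%N
    & g_prod x - ramp_down G - (1 - (is_on (g_onoff x))%:R) * bmin G
        <= a_prod a
        <= g_prod x + ramp_up G + (just_started (g_onoff x))%:R * bmin G]].

(* On states satisfying onoff_ok the cases below are exclusive, and the last
   one is beta = min_down. *)
Definition next_onoff y (u : bool) : onoff :=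
  if (0 < y.1 < min_up G)%N then (y.1.+1, 0%N)
  else if (0 < y.2 < min_down G)%N then (0%N, y.2.+1)
  else if y.1 == min_up G then (if u then (min_up G, 0%N) else (0%N, 1%N))
  else (if u then (1%N, 0%N) else (0%N, min_down G)).

Definition next_gstate x a (w : R) : gstate R :=
  GState (next_onoff (g_onoff x) (a_commit a)) (a_prod a) w.

Definition startup y (u : bool) : R :=
  if (y == (0%N, min_down G)) && u then startup_cost G else 0.

(* T is the number of periods *)
Definition gcost (T t : nat) x a : R :=
  if (t < T)%N then
    startup (g_onoff x) (a_commit a) + noload_cost G * (a_commit a)%:R
      + gen_cost G t (a_prod a)
  else gen_cost G t (a_prod a).

Definition generator_ok (T : nat) : Prop :=
  [/\ (1 <= min_up G)%N, (1 <= min_down G)%N, bmin G <= bmax G &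
    forall t, (1 <= t <= T)%N ->
      {within `[bmin G, bmax G], continuous (gen_cost G t)} /\
      piecewise_linear (bmin G) (bmax G) (gen_cost G t)].

End Generator.

(* V is an ambient type for the summary states.  The functions summary_fun t
   and the multipliers are total; only their values on demand_set t and
   summary_set t matter.  trans t d w is P_t(w | d).  The set demand_set T.+1
   and the kernel trans T are placeholders for the irrelevant D_(T+1). *)
Record uc_model (R : realType) (n : nat) (V : choiceType) := UCModel {
  horizon : nat;
  gens : 'I_n -> generator R;
  demand_set : nat -> {fset R};
  trans : nat -> R -> R -> R;
  summary_init : V;
  summary_fun : nat -> V -> R -> V;
  summary_set : nat -> {fset V}
}.

Section Model.
Variables (R : realType) (n : nat) (V : choiceType) (M : uc_model R n V).
Implicit Types (x : sstate R n) (v : V) (a : 'I_n -> gaction R).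

Definition model_ok : Prop :=
  [/\ forall i, generator_ok (gens M i) (horizon M),
      demand_set M 1%N = [fset (0 : R)]%fset,
      forall t d w, (1 <= t <= horizon M)%N -> d \in demand_set M t ->
        w \in demand_set M t.+1 -> 0 <= trans M t d w
    & forall t d, (1 <= t <= horizon M)%N -> d \in demand_set M t ->
        \sum_(w <- demand_set M t.+1) trans M t d w = 1].

Definition gstate_set (i : 'I_n) (t : nat) : set (gstate R) :=
  if t == 1%N then [set GState (0%N, min_down (gens M i)) 0 0]
  else [set x | [/\ onoff_ok (gens M i) (g_onoff x),
    g_prod x = 0 \/ bmin (gens M i) <= g_prod x <= bmax (gens M i)
    & g_demand x \in demand_set M t]].

(* The second clause follows from the first one unless n = 0. *)
Definition sstate_set (t : nat) : set (sstate R n) :=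
  [set x | (forall i, gstate_set i t (scomp x i)) /\
           s_demand x \in demand_set M t].

Definition action_set x : set ('I_n -> gaction R) :=
  [set a | forall i, gaction_set (gens M i) (scomp x i) (a i)].

Definition next_sstate x a (w : R) : sstate R n :=
  SState (fun i => next_onoff (gens M i) (s_onoff x i) (a_commit (a i)))
    (fun i => a_prod (a i)) w.

Definition cost (t : nat) x a : R :=
  \sum_(i < n) gcost (gens M i) (horizon M) t (scomp x i) (a i).

(* Expectation over D_(t+1) ~ P_t(. | d). *)
Definition expect_next (t : nat) (d : R) (phi : R -> \bar R) : \bar R :=
  (\sum_(w <- demand_set M t.+1) (trans M t d w)%:E * phi w)%E.

(* The summary state reached at period t along the demand path h. *)
Fixpoint summary (h : nat -> R) (t : nat) : V :=
  match t with
  | (s.+1 as r).+1 => summary_fun M r.+1 (summary h r) (h r.+1)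
  | _ => summary_init M
  end.

Section Lagrangian.
Variable lambda : nat -> V -> R.

Definition lagr_objective (t : nat) x v (Lnext : sstate R n -> V -> \bar R) a :
    \bar R :=
  expect_next t (s_demand x) (fun w =>
    ((cost t x a + lambda t v * (\sum_(i < n) a_prod (a i) - s_demand x))%:E
     + Lnext (next_sstate x a w) (summary_fun M t.+1 v w))%E).

Definition lagr_values (t : nat) x v (Lnext : sstate R n -> V -> \bar R) :
    set (\bar R) :=
  [set lagr_objective t x v Lnext a | a in action_set x].

(* k = T + 1 - t stages remain.  The recursion is written with ereal_inf, which
   is the minimum whenever one exists and +oo on the empty set. *)
Fixpoint lagr_togo (k t : nat) x v : \bar R :=
  if k is k'.+1 then ereal_inf (lagr_values t x v (lagr_togo k' t.+1))
  else 0%E.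

Definition lagr (t : nat) : sstate R n -> V -> \bar R :=
  lagr_togo ((horizon M).+1 - t) t.

Definition glagr_objective (i : 'I_n) (t : nat) (xi : gstate R) v
    (Lnext : gstate R -> V -> \bar R) (ai : gaction R) : \bar R :=
  expect_next t (g_demand xi) (fun w =>
    ((gcost (gens M i) (horizon M) t xi ai + lambda t v * a_prod ai)%:E
     + Lnext (next_gstate (gens M i) xi ai w) (summary_fun M t.+1 v w))%E).

Definition glagr_values (i : 'I_n) (t : nat) (xi : gstate R) v
    (Lnext : gstate R -> V -> \bar R) : set (\bar R) :=
  [set glagr_objective i t xi v Lnext ai | ai in gaction_set (gens M i) xi].

Fixpoint glagr_togo (i : 'I_n) (k t : nat) (xi : gstate R) v : \bar R :=
  if k is k'.+1 then ereal_inf (glagr_values i t xi v (glagr_togo i k' t.+1))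
  else 0%E.

Definition glagr (i : 'I_n) (t : nat) : gstate R -> V -> \bar R :=
  glagr_togo i ((horizon M).+1 - t) t.

End Lagrangian.

Section Demand.
Variables (d : measure_display) (Omega : measurableType d).
Variables (P : probability Omega R) (D : nat -> {RV P >-> R}).

(* Meaningful when B has positive probability. *)
Definition cond_prob (A B : set Omega) : R := fine (P (A `&` B)) / fine (P B).
Definition cond_expect (X : Omega -> R) (B : set Omega) : R :=
  (\int[P]_(omega in B) X omega) / fine (P B).

(* The event D_1 = h_1, ..., D_t = h_t. *)
Definition history (h : nat -> R) (t : nat) : set Omega :=
  [set omega | forall s, (1 <= s <= t)%N -> D s omega = h s].

Definition summary_rv (t : nat) (omega : Omega) : V :=
  summary (fun s => D s omega) t.

Definition demand_process : Prop :=
  [/\ forall t omega, (1 <= t <= horizon M)%N -> D t omega \in demand_set M t,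
      forall t h w, (1 <= t < horizon M)%N -> (0 < P (history h t))%E ->
        cond_prob [set omega | D t.+1 omega = w] (history h t) =
        cond_prob [set omega | D t.+1 omega = w]
                  [set omega | D t omega = h t],
      forall t e w, (1 <= t < horizon M)%N ->
        (0 < P [set omega | D t omega = e])%E -> w \in demand_set M t.+1 ->
        trans M t e w =
        cond_prob [set omega | D t.+1 omega = w] [set omega | D t omega = e]
    & forall t omega, (1 <= t <= horizon M)%N ->
        summary_rv t omega \in summary_set M t].

(* For r > t, the conditional distribution of D_r given D_1, ..., D_t depends
   only on v_t. *)
Definition summary_sufficient : Prop :=
  forall t r h h', (1 <= t < r)%N -> (r <= horizon M)%N ->
    (0 < P (history h t))%E -> (0 < P (history h' t))%E ->
    summary h t = summary h' t ->
    forall w, cond_prob [set omega | D r omega = w] (history h t) =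
              cond_prob [set omega | D r omega = w] (history h' t).

Definition consistent (t : nat) (e : R) v : Prop :=
  (0 < P [set omega | D t omega = e /\ summary_rv t omega = v])%E.

(* E[lambda_r(v_r) D_r | v_t = v]; for r = t it is lambda_t(v) e, where e is the
   demand component of the current state, which v need not determine. *)
Definition expected_priced_demand (lambda : nat -> V -> R) (t r : nat) v
    (e : R) : R :=
  if r == t then lambda t v * e
  else cond_expect (fun omega => lambda r (summary_rv r omega) * D r omega)
                   [set omega | summary_rv t omega = v].

End Demand.
End Model.

(* Main.v *)
(* With the demand prices written as the expectations of the Markov chain
   (D, v) under the kernels P_t, the Lagrangian recursion splits by backward
   induction: a minimum over a product of action sets of a sum of separate
   objectives is the sum of the minima.  These expectations are
   E[lambda_r(v_r) D_r | v_t] because the standing assumption, applied with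
   r = t + 1, makes the one-step law of demand at a reachable state depend on
   v_t only; integrals over {v_t = v} are computed by conditioning on the
   finitely many demand histories.

   The minima are attained because each L_t^i is lower semicontinuous in the
   previous production level: for a fixed commitment, minimizing over a compact
   range intersected with a window [q - a, q + b] preserves lower
   semicontinuity in q. *)
Require Import Defs.
From mathcomp Require Import all_boot all_order all_algebra finmap.
From mathcomp Require Import all_classical all_reals all_analysis.
From mathcomp Require Import ring lra.
Set Implicit Arguments.
Unset Strict Implicit.
Unset Printing Implicit Defensive.
Import Order.TTheory GRing.Theory Num.Theory.
Import numFieldNormedType.Exports.
Local Open Scope classical_set_scope.
Local Open Scope ring_scope.

(** * Extended reals and minima *)

(** The value +oo is legitimate, being the minimum over an empty action set, so finiteness cannot be
    carried along; excluding -oo is what keeps all sums below well defined. The case p = 0 uses the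
    convention 0 * oo = 0. *)
Lemma mulpe_neqNy (R : realType) (p : R) (x : \bar R) : 0 <= p -> x != -oo%E ->
  (p%:E * x != -oo)%E.
Proof.
rewrite le_eqVlt => /predU1P[<- _|p0]; first by rewrite mul0e.
by case: x => [r| |] // _; rewrite gt0_muley.
Qed.

Lemma sume_neqNy (R : realType) (I : eqType) (s : seq I) (F : I -> \bar R) :
  (forall i, i \in s -> F i != -oo%E) -> (\sum_(i <- s) F i != -oo)%E.
Proof.
move=> FN; rewrite big_seq; elim/big_ind: _ => // x y xN yN.
by rewrite adde_eq_ninfty negb_or xN.
Qed.

Lemma sume_distrr_neqNy (R : realType) (I : eqType) (s : seq I) (p : R)
    (F : I -> \bar R) : (forall i, F i != -oo%E) ->
  (p%:E * (\sum_(i <- s) F i) = \sum_(i <- s) p%:E * F i)%E.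
Proof.
move=> FN; apply: fin_num_sume_distrr => // i j _ _.
by apply: ltninfty_adde_def; rewrite inE ltNye.
Qed.

Lemma ereal_between (R : realType) (x y : \bar R) : (x < y)%E ->
  exists2 c : \bar R, (x < c)%E & (c < y)%E.
Proof.
case: x y => [r| |] [s| |] // rs.
- by exists ((r + s) / 2)%:E; move: rs; rewrite !lte_fin; lra.
- by exists (r + 1)%:E; rewrite ?ltry // lte_fin; lra.
- by exists (s - 1)%:E; rewrite ?ltNyr // lte_fin; lra.
- by exists 0%:E; rewrite ?ltNyr ?ltry.
Qed.

Lemma is_emin_inf (R : realType) (S : set (\bar R)) (m : \bar R) :
  is_emin S m -> ereal_inf S = m.
Proof.
case=> [[-> ->]|[Sm lbm]]; first exact: ereal_inf0.
apply/eqP; rewrite eq_le; apply/andP; split; first exact: ereal_inf_lbound.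
exact: le_ereal_inf_tmp.
Qed.

Lemma is_eminU (R : realType) (A B : set (\bar R)) (a b : \bar R) :
  is_emin A a -> is_emin B b -> is_emin (A `|` B) (Order.min a b).
Proof.
case=> [[-> ->]|[Aa lba]]; case=> [[-> ->]|[Bb lbb]].
- by left; rewrite setU0 minxx.
- by right; rewrite set0U minye.
- by right; rewrite setU0 miney.
- right; split.
    by case: (leP a b) => _; [left|right].
  move=> x [/lba|/lbb] le_x; rewrite ge_min le_x ?orbT //.
Qed.

(** If some [S i] is empty, so is the product, and the sum of minima is +oo because no other term
    can be -oo. Otherwise a choice of one minimizer per coordinate is a minimizer of the sum. *)
Lemma is_emin_sum (R : realType) (n : nat) (A : Type)
    (S : 'I_n -> set A) (phi : 'I_n -> A -> \bar R) (m : 'I_n -> \bar R) (c : R) :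
  (forall i a, phi i a != -oo%E) ->
  (forall i, is_emin (phi i @` S i) (m i)) ->
  is_emin ((fun a : 'I_n -> A => (\sum_(i < n) phi i (a i) - c%:E)%E) @`
             [set a | forall i, S i (a i)])
    (\sum_(i < n) m i - c%:E)%E.
Proof.
move=> phiN phim.
have mN i : m i != -oo%E by case: (phim i) => [[_ ->]|[[a _ <-] _]].
have [[i Si0]|Sn0] := pselect (exists i, S i = set0).
  left; split.
    apply/seteqP; split => // b [a Sa _].
    by have := Sa i; rewrite Si0.
  suff -> : (\sum_(i < n) m i = +oo)%E by [].
  apply/esum_eqyP => //; exists i; split; rewrite ?mem_index_enum //.
  by have [[]//|[[a Sa _] _]] := phim i; rewrite Si0 in Sa.
have {}phim i : (phi i @` S i) (m i) /\ lbound (phi i @` S i) (m i).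
  have [[Si0 _]|//] := phim i; exfalso; apply: Sn0; exists i.
  exact: image_set0_set0 Si0.
have /choice[a aP] i : exists a, S i a /\ phi i a = m i.
  by have [[a Sa ma] _] := phim i; exists a.
right; split.
  exists a => [i|]; first by have [] := aP i.
  by congr (_ - _)%E; apply: eq_bigr => i _; have [] := aP i.
move=> _ [b Sb <-]; apply: leeB => //; apply: lee_sum => i _.
by have [_] := phim i; apply; exists (b i).
Qed.

(** * Lower semicontinuity *)

Section LowerSemicontinuity.
Variable R : realType.
Implicit Types (K : set R) (f g : R -> \bar R).

(** Lower semicontinuity relative to [K]. Real thresholds suffice for extended values; where [f] is
    -oo the condition is void. *)
Definition lsc_on K f : Prop := forall z, K z -> forall a : R,
  (a%:E < f z)%E -> \forall y \near within K (nbhs z), (a%:E < f y)%E.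

Lemma lsc_on_subset K K' f : K `<=` K' -> lsc_on K' f -> lsc_on K f.
Proof.
move=> KK' lf z Kz a az; have := lf z (KK' _ Kz) a az.
by rewrite !near_withinE; apply: filterS => y Py /KK' /Py.
Qed.

Lemma lsc_on_cst K (c : \bar R) : lsc_on K (fun=> c).
Proof. by move=> z _ a az; apply: filterE => y. Qed.

Lemma lsc_onD K f g : (forall z, f z != -oo%E) -> (forall z, g z != -oo%E) ->
  lsc_on K f -> lsc_on K g -> lsc_on K (fun z => (f z + g z)%E).
Proof.
move=> fNy gNy lf lg z Kz a afg.
(* The threshold is shared between the summands: half of the slack is taken off each if both are
   finite, and an infinite summand absorbs whatever the other cannot cover. *)
suff [b [c [bf cg abc]]] : exists b c : R,
    [/\ (b%:E < f z)%E, (c%:E < g z)%E & a <= b + c].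
  have nf := lf z Kz b bf; have ng := lg z Kz c cg.
  apply: filterS2 nf ng => y yb yc.
  by apply: le_lt_trans (lteD yb yc); rewrite -EFinD lee_fin.
move: afg (fNy z) (gNy z); case: (f z) => [r| |] //; case: (g z) => [s| |] //.
- rewrite -EFinD lte_fin => ars _ _.
  by exists (r - (r + s - a) / 2), (s - (r + s - a) / 2); rewrite !lte_fin;
    split; lra.
- by move=> _ _ _; exists (r - 1), (a - r + 1); rewrite !lte_fin ltry; split => //; lra.
- by move=> _ _ _; exists (a - s + 1), (s - 1); rewrite !lte_fin ltry; split => //; lra.
- by move=> _ _ _; exists a, 0; rewrite !ltry addr0.
Qed.

Lemma lsc_on_min K f g : lsc_on K f -> lsc_on K g ->
  lsc_on K (fun z => Order.min (f z) (g z)).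
Proof.
move=> lf lg z Kz a; rewrite lt_min => /andP[af ag].
apply: filterS2 (lf z Kz a af) (lg z Kz a ag) => y yf yg.
by rewrite lt_min yf.
Qed.

Lemma lsc_onZ K (p : R) f : 0 <= p -> lsc_on K f ->
  lsc_on K (fun z => (p%:E * f z)%E).
Proof.
rewrite le_eqVlt => /predU1P[<- _|p0 lf].
  under eq_fun do rewrite mul0e; exact: lsc_on_cst.
move=> z Kz a; rewrite muleC -lte_pdivrMr// => /(lf z Kz).
by apply: filterS => y; rewrite muleC -lte_pdivrMr.
Qed.

Lemma lsc_on_sum K (I : eqType) (s : seq I) (F : I -> R -> \bar R) :
  (forall i, i \in s -> forall z, F i z != -oo%E) ->
  (forall i, i \in s -> lsc_on K (F i)) ->
  lsc_on K (fun z => (\sum_(i <- s) F i z)%E).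
Proof.
elim: s => [|i s IH] FNy lF.
  under eq_fun do rewrite big_nil; exact: lsc_on_cst.
under eq_fun do rewrite big_cons.
apply: lsc_onD.
- by apply: FNy; rewrite mem_head.
- by move=> z; apply: sume_neqNy => j js; apply: FNy; rewrite inE js orbT.
- by apply: lF; rewrite mem_head.
- apply: IH => j js; [apply: FNy|apply: lF]; by rewrite inE js orbT.
Qed.

Lemma lsc_on_EFin K (f : R -> R) :
  {within K, continuous f} -> lsc_on K (fun z => (f z)%:E).
Proof.
move=> /subspace_continuousP cf z Kz a; rewrite lte_fin => az.
have /cf := Kz; move/cvgr_gt => /(_ _ az).
by apply: filterS => y; rewrite lte_fin.
Qed.

(** A point of the closure where [f] exceeds [c] would have a neighbourhood in [K] on which [f]
    stays above a real [a >= c], hence disjoint from the sublevel set. *)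
Lemma closed_lsc_sublevel K f (c : \bar R) : closed K -> lsc_on K f ->
  closed (K `&` [set z | (f z <= c)%E]).
Proof.
move=> clK lf z cz.
have Kz : K z by apply: clK; apply: closure_subset cz => y [].
split => //=; rewrite leNgt; apply/negP => cfz.
have [a ca afz] : exists2 a : R, (c <= a%:E)%E & (a%:E < f z)%E.
  case: c cfz {cz} => [c| |] /=; first by exists c.
    by rewrite ltNge leey.
  case: (f z) => [r| |] // _; last by exists 0; rewrite ?leNye ?ltry.
  by exists (r - 1); rewrite ?leNye // lte_fin; lra.
have [y [[Ky /= fyc] /(_ Ky)]] := cz _ (lf z Kz a afz).
by rewrite ltNge (le_trans fyc ca).
Qed.

Lemma lsc_onT_closed f :
  (forall c : R, closed [set z | (f z <= c%:E)%E]) -> lsc_on setT f.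
Proof.
move=> clf z _ a az.
have oU : open (~` [set z | (f z <= a%:E)%E]) by apply: closed_openC.
have : nbhs z (~` [set z | (f z <= a%:E)%E]).
  by apply: open_nbhs_nbhs; split => //=; apply/negP; rewrite -ltNge.
by apply: filterS => y /= /negP; rewrite -ltNge.
Qed.

(* The sublevel sets above the infimum form a filter base of closed subsets of
   a compact set, and any cluster point is a minimizer. *)
Lemma lsc_on_attained K f : compact K -> lsc_on K f ->
  is_emin (f @` K) (ereal_inf (f @` K)).
Proof.
move=> cK lf; set m := ereal_inf _.
have [K0|/set0P[z0 Kz0]] := eqVneq K set0.
  by left; rewrite /m K0 image_set0 ereal_inf0.
right; split; last by move=> y; exact: ereal_inf_lbound.
(* No level lies strictly above +oo, so the filter would be empty; but then every point of [K] is a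
   minimizer. *)
have [my|mNy] := eqVneq m +oo%E.
  exists z0 => //; apply/eqP; rewrite my eq_le leey /= -my.
  by apply: ereal_inf_lbound; exists z0.
have my : (m < +oo)%E by rewrite lt_neqAle mNy leey.
pose lev (c : \bar R) := K `&` [set z | (f z <= c)%E].
pose Fl := filter_from [set c : \bar R | (m < c)%E] lev.
have lev_ne c : (m < c)%E -> lev c !=set0.
  move=> mc; have [_ [z Kz <-] fzc] := ereal_inf_lt mc.
  by exists z; split => //=; exact: ltW.
have PF : ProperFilter Fl.
  apply: filter_from_proper; last exact: lev_ne.
  apply: filter_from_filter; first by exists +oo%E; exact: my.
  move=> c c' /= mc mc'; exists (Order.min c c'); first by rewrite /= lt_min mc.
  by move=> z [Kz /=]; rewrite le_min => /andP[? ?]; split.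
have FK : Fl K by exists +oo%E; [exact: my|move=> z []].
have [z [Kz clz]] := cK Fl PF FK.
exists z => //; apply/eqP; rewrite eq_le; apply/andP; split; last first.
  by apply: ereal_inf_lbound; exists z.
rewrite leNgt; apply/negP => mfz.
(* A level strictly between the infimum and [f z] gives a closed member of the filter, which must
   contain the cluster point [z]. *)
have [c mc cfz] := ereal_between mfz.
have /(_ z) clev := closed_lsc_sublevel (c := c) (compact_closed (@norm_hausdorff _ _) cK) lf.
have [] : lev c z.
  apply: clev; move: clz; rewrite clusterE => clz.
  by apply: clz; exists c.
by move=> _ /=; rewrite leNgt cfz.
Qed.

Lemma compactI_itv K (a b : R) : compact K -> compact (K `&` `[a, b]).
Proof.
move=> cK; apply: compact_closedI => //; exact: itv_closed.
Qed.

(* The sublevel set at c of the infimum is the sum of the compact sublevel set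
   of f and of the compact interval [-b, a]. *)
Lemma lsc_on_window_inf K f (a b : R) : compact K -> lsc_on K f ->
  lsc_on setT (fun q => ereal_inf (f @` (K `&` `[q - a, q + b]))).
Proof.
move=> cK lf; apply: lsc_onT_closed => c.
have cS : compact (K `&` [set z | (f z <= c%:E)%E]).
  apply: (subclosed_compact _ cK) => [|z []//].
  by apply: closed_lsc_sublevel => //; exact: compact_closed cK.
suff -> : [set q | (ereal_inf (f @` (K `&` `[(q - a)%R, (q + b)%R])) <= c%:E)%E]
    = (fun p => p.1 + p.2) @`
        ((K `&` [set z | (f z <= c%:E)%E]) `*` `[- b, a]).
  apply: compact_closed; first exact: norm_hausdorff.
  apply: continuous_compact; last first.
    by apply: compact_setX => //; exact: segment_compact.
  by apply: continuous_subspaceT => p; exact: add_continuous.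
apply/seteqP; split => [q /= infq|_ /= [[z s] /= [[Kz fz] sab] <-]].
  (* Attainment turns an infimum at most [c] into an actual point [z] of the window; then q = z + (q
     - z) with q - z in [-b, a]. *)
  have := lsc_on_attained (compactI_itv (a := q - a) (b := q + b) cK)
            (lsc_on_subset (@subIsetl _ _ _) lf).
  case=> [[_ Einf]|[[z [Kz zq] fz] _]]; first by rewrite Einf leye_eq in infq.
  exists (z, q - z) => /=; last by rewrite addrC subrK.
  split; first by split => //=; rewrite fz.
  by move: zq; rewrite /= !in_itv /= => /andP[? ?]; lra.
apply: le_trans fz; apply: ereal_inf_lbound; exists z => //; split => //.
by move: sab; rewrite /= !in_itv /= => /andP[? ?]; lra.
Qed.

End LowerSemicontinuity.

(** * Attained minima for one generator *)

Section Generator.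
Variables (R : realType) (n : nat) (V : choiceType) (M : uc_model R n V).
Hypothesis Mok : model_ok M.
Variable lambda : nat -> V -> R.
Local Notation T := (horizon M).

(** The invariant of the backward induction: continuity matters only in the production level, the
    one continuous component of the state. *)
Definition regular (D : {fset R}) (L : gstate R -> V -> \bar R) : Prop :=
  forall y w v, w \in D -> (forall q, L (GState y q w) v != -oo%E) /\
    lsc_on setT (fun q => L (GState y q w) v).

Lemma transP t d : (1 <= t <= T)%N -> d \in demand_set M t ->
  (forall w, w \in demand_set M t.+1 -> 0 <= trans M t d w) /\
  \sum_(w <- demand_set M t.+1) trans M t d w = 1.
Proof. by case: Mok => _ _ H1 H2 tT dD; split=> [w|]; [exact: H1|exact: H2]. Qed.

Lemma expect_next_neqNy t d (phi : R -> \bar R) :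
  (1 <= t <= T)%N -> d \in demand_set M t ->
  (forall w, w \in demand_set M t.+1 -> phi w != -oo%E) ->
  expect_next M t d phi != -oo%E.
Proof.
move=> tT dD phiN; have [p0 _] := transP tT dD.
by apply: sume_neqNy => w wD; apply: mulpe_neqNy; [exact: p0|exact: phiN].
Qed.

Lemma glagr_objective_neqNy i t x v L a : (1 <= t <= T)%N ->
  g_demand x \in demand_set M t -> regular (demand_set M t.+1) L ->
  glagr_objective M lambda i t x v L a != -oo%E.
Proof.
move=> tT xD Lr; apply: expect_next_neqNy => // w wD.
rewrite adde_eq_ninfty negb_or /=.
by case: (Lr (next_onoff (gens M i) (g_onoff x) (a_commit a)) w
            (summary_fun M t.+1 v w) wD) => /(_ (a_prod a)).
Qed.

(** * Feasible productions and the objective at a fixed commitment *)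

Definition prod_range (G : generator R) (y : onoff) : set R :=
  `[(is_on G y)%:R * bmin G, (is_on G y)%:R * bmax G].

(** Both ramp constraints are put in the form [q - a, q + b] with [a] and [b] independent of [q], as
    [lsc_on_window_inf] requires. *)
Definition ramp_window (G : generator R) (y : onoff) (q : R) : set R :=
  `[q - (ramp_down G + (1 - (is_on G y)%:R) * bmin G),
    q + (ramp_up G + (just_started y)%:R * bmin G)].

Definition commit_ok (G : generator R) (y : onoff) (u : bool) : bool :=
  (must_stay_on G y <= u <= may_be_on G y)%N.

Lemma gaction_setE G y q d z u : gaction_set G (GState y q d) (GAction z u) <->
  commit_ok G y u /\ (prod_range G y `&` ramp_window G y q) z.
Proof.
rewrite /gaction_set /commit_ok /prod_range /ramp_window /= !in_itv /=.
rewrite opprD !addrA; split => [[? ? ?]|[? []]]; by split.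
Qed.

(** For a generator that is off, the range is the single point 0, where semicontinuity is automatic
    even if the cost jumps between 0 and [bmin, bmax]. *)
Lemma lsc_gen_cost i t y : (1 <= t <= T)%N ->
  lsc_on (prod_range (gens M i) y) (fun z => (gen_cost (gens M i) t z)%:E).
Proof.
move=> tT; case: Mok => /(_ i)[_ _ _ /(_ t tT)[cF _]] _ _ _.
rewrite /prod_range; case: is_on; first by rewrite !mul1r; exact: lsc_on_EFin.
rewrite !mul0r set_itv1 => z -> a az.
by rewrite near_withinE; apply: filterE => y' ->.
Qed.

(** The next on/off status is fixed by [y] and [u], and [z] is the next previous-production level,
    so the invariant on [L] applies; nonnegative probabilities preserve semicontinuity. *)
Lemma lsc_glagr_objective i t y q d v L u : (1 <= t <= T)%N ->
  d \in demand_set M t -> regular (demand_set M t.+1) L ->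
  lsc_on (prod_range (gens M i) y) (fun z =>
    glagr_objective M lambda i t (GState y q d) v L (GAction z u)).
Proof.
move=> tT dD Lr; have [p0 _] := transP tT dD.
have L'N w z : w \in demand_set M t.+1 ->
    L (GState (next_onoff (gens M i) y u) z w) (summary_fun M t.+1 v w)
      != -oo%E.
  by move=> wD; have [] := Lr (next_onoff (gens M i) y u) w (summary_fun M t.+1 v w) wD.
rewrite /glagr_objective /expect_next /=; apply: lsc_on_sum => w wD.
  move=> z; apply: mulpe_neqNy; first exact: p0.
  by rewrite adde_eq_ninfty negb_or /= L'N.
apply: lsc_onZ; first exact: p0.
apply: lsc_onD => //; first by move=> z; exact: L'N.
  (* [c] gathers the charges that do not depend on [z]; the last period has none. *)
  pose c := if (t < T)%N then startup (gens M i) y u +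
    noload_cost (gens M i) * u%:R else 0.
  rewrite (_ : (fun z => _) = (fun z =>
      (gen_cost (gens M i) t z)%:E + (c + lambda t v * z)%:E)%E); last first.
    apply/funext => z; rewrite -EFinD /gcost /c /=; congr _%:E.
    by case: ifP => _; ring.
  apply: lsc_onD => //; first exact: lsc_gen_cost.
  apply: lsc_on_EFin; apply: continuous_subspaceT => z.
  by apply: cvgD; [exact: cvg_cst|apply: cvgM; [exact: cvg_cst|exact: cvg_id]].
have [_] := Lr (next_onoff (gens M i) y u) w (summary_fun M t.+1 v w) wD.
exact: lsc_on_subset.
Qed.

(** * One backward step for a single generator *)

Section Step.
Variables (i : 'I_n) (t : nat) (y : onoff) (d : R) (v : V).
Variable L : gstate R -> V -> \bar R.
Hypotheses (tT : (1 <= t <= T)%N) (dD : d \in demand_set M t).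
Hypothesis Lr : regular (demand_set M t.+1) L.
Local Notation G := (gens M i).

(** The previous production enters through the ramp window only, so the objective can be evaluated
    at production 0, making it one function of [z] for all [q]. *)
Definition committed_values (q : R) (u : bool) : set (\bar R) :=
  if commit_ok G y u then
    (fun z => glagr_objective M lambda i t (GState y 0 d) v L (GAction z u))
      @` (prod_range G y `&` ramp_window G y q)
  else set0.

Lemma glagr_valuesE q :
  glagr_values M lambda i t (GState y q d) v L =
  committed_values q true `|` committed_values q false.
Proof.
rewrite /committed_values; apply/seteqP; split.
  move=> _ [[z u] /gaction_setE[uok zok] <-].
  by case: u uok => ->; [left|right]; exists z.
move=> x []; case: ifP => //= uok [z zok <-].
  by exists (GAction z true) => //; apply/gaction_setE.
by exists (GAction z false) => //; apply/gaction_setE.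
Qed.

Lemma committed_values_min q u :
  is_emin (committed_values q u) (ereal_inf (committed_values q u)).
Proof.
rewrite /committed_values; case: ifP => _; last by left; rewrite ereal_inf0.
apply: lsc_on_attained; first by apply: compactI_itv; exact: segment_compact.
apply: (@lsc_on_subset _ _ (prod_range G y)); first by move=> z [].
exact: lsc_glagr_objective.
Qed.

Lemma glagr_values_min q :
  is_emin (glagr_values M lambda i t (GState y q d) v L)
    (ereal_inf (glagr_values M lambda i t (GState y q d) v L)).
Proof.
have := is_eminU (committed_values_min q true) (committed_values_min q false).
by rewrite -glagr_valuesE => Hm; rewrite (is_emin_inf Hm).
Qed.

Lemma glagr_inf_neqNy q :
  ereal_inf (glagr_values M lambda i t (GState y q d) v L) != -oo%E.
Proof.
have [[_ ->]//|[[a _ <-] _]] := glagr_values_min q.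
exact: glagr_objective_neqNy.
Qed.

(** Admissibility of a commitment depends on [y] alone. For each of the two, the infimum as a
    function of [q] is either a window infimum or constantly +oo, and a minimum of two
    semicontinuous functions is semicontinuous. *)
Lemma lsc_glagr_inf : lsc_on setT (fun q =>
  ereal_inf (glagr_values M lambda i t (GState y q d) v L)).
Proof.
rewrite (_ : (fun q => _) = (fun q =>
    Order.min (ereal_inf (committed_values q true))
              (ereal_inf (committed_values q false)))); last first.
  apply/funext => q; rewrite glagr_valuesE; apply: is_emin_inf.
  by apply: is_eminU; exact: committed_values_min.
apply: lsc_on_min; rewrite /committed_values; case: (commit_ok _ _ _).
- apply: (@lsc_on_window_inf _ (prod_range G y)); first exact: segment_compact.
  exact: lsc_glagr_objective.
- exact: lsc_on_cst.
- apply: (@lsc_on_window_inf _ (prod_range G y)); first exact: segment_compact.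
  exact: lsc_glagr_objective.
- exact: lsc_on_cst.
Qed.

End Step.

Lemma glagr_togo_regular i k t : (0 < t)%N -> (k + t = T.+1)%N ->
  regular (demand_set M t) (glagr_togo M lambda i k t).
Proof.
elim: k t => [|k IH] t t0 ktT y w v wD /=.
  by split => //; exact: lsc_on_cst.
have tT : (1 <= t <= T)%N by rewrite t0 /= -ltnS -ktT addSn ltnS leq_addl.
have Lr : regular (demand_set M t.+1) (glagr_togo M lambda i k t.+1).
  by apply: IH => //; rewrite -ktT addnS.
by split=> [q|]; [exact: glagr_inf_neqNy|exact: lsc_glagr_inf].
Qed.

End Generator.

(** * Decoupling *)

Section Decoupling.
Variables (R : realType) (n : nat) (V : choiceType) (M : uc_model R n V).
Hypothesis Mok : model_ok M.
Variable lambda : nat -> V -> R.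
Local Notation T := (horizon M).

(* E[lambda_(t+k)(v_(t+k)) D_(t+k)] for the Markov chain (D, v) started at
   (e, v) in period t. *)
Fixpoint priced_demand (k t : nat) (v : V) (e : R) : R :=
  if k is k'.+1 then \sum_(w <- demand_set M t.+1)
    trans M t e w * priced_demand k' t.+1 (summary_fun M t.+1 v w) w
  else lambda t v * e.

Definition total_priced_demand (k t : nat) (v : V) (e : R) : R :=
  \sum_(j < k) priced_demand j t v e.

Lemma total_priced_demandS k t v e :
  total_priced_demand k.+1 t v e = lambda t v * e +
  \sum_(w <- demand_set M t.+1)
    trans M t e w * total_priced_demand k t.+1 (summary_fun M t.+1 v w) w.
Proof.
rewrite /total_priced_demand big_ord_recl /=; congr (_ + _).
by rewrite exchange_big; apply: eq_bigr => w _; rewrite mulr_sumr.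
Qed.

(** Expectation is a finite weighted sum, so it commutes with the sum over generators, and the
    demand terms are finite and can be subtracted outside. *)
Lemma lagr_objective_split k t x v a : (1 <= t <= T)%N ->
  s_demand x \in demand_set M t ->
  (forall i, regular (demand_set M t.+1) (glagr_togo M lambda i k t.+1)) ->
  (forall x' v', s_demand x' \in demand_set M t.+1 ->
    lagr_togo M lambda k t.+1 x' v' =
    (\sum_(i < n) glagr_togo M lambda i k t.+1 (scomp x' i) v'
     - (total_priced_demand k t.+1 v' (s_demand x'))%:E)%E) ->
  lagr_objective M lambda t x v (lagr_togo M lambda k t.+1) a =
  (\sum_(i < n) glagr_objective M lambda i t (scomp x i) v
                  (glagr_togo M lambda i k t.+1) (a i)
   - (total_priced_demand k.+1 t v (s_demand x))%:E)%E.
Proof.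
move=> tT xD Lr IH; have [_ p1] := transP Mok tT xD.
set e := s_demand x in xD p1 *.
pose Li w i := glagr_togo M lambda i k t.+1
  (next_gstate (gens M i) (scomp x i) (a i) w) (summary_fun M t.+1 v w).
pose gi i := gcost (gens M i) T t (scomp x i) (a i) + lambda t v * a_prod (a i).
pose ct w := lambda t v * e
  + total_priced_demand k t.+1 (summary_fun M t.+1 v w) w.
have LiN w i : w \in demand_set M t.+1 -> Li w i != -oo%E.
  move=> wD; rewrite /Li /next_gstate.
  by have [] := Lr i (next_onoff (gens M i) (g_onoff (scomp x i))
    (a_commit (a i))) w (summary_fun M t.+1 v w) wD.
(* For each demand outcome, the induction hypothesis on the continuation separates the
   generators. *)
have -> : lagr_objective M lambda t x v (lagr_togo M lambda k t.+1) a =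
    (\sum_(w <- demand_set M t.+1)
       (\sum_(i < n) (trans M t e w)%:E * ((gi i)%:E + Li w i)
        - (trans M t e w * ct w)%:E))%E.
  rewrite /lagr_objective /expect_next big_seq [RHS]big_seq.
  apply: eq_bigr => w wD; rewrite IH // -sume_distrr_neqNy; last first.
    by move=> i; rewrite adde_eq_ninfty negb_or LiN.
  rewrite EFinM -muleBr //; last first.
    by rewrite fin_num_adde_defl // fin_numN.
  congr (_ * _)%E; rewrite big_split /= sumEFin.
  have -> : \sum_(i < n) gi i = cost M t x a + lambda t v * \sum_(i < n) a_prod (a i).
    by rewrite big_split /= mulr_sumr.
  rewrite /ct -/e -[X in (_ + (X + _))%E]/(\sum_(i < n) Li w i)%E.
  case: (\sum_(i < n) Li w i)%E => [r| |] //=; rewrite -!EFinD; congr _%:E; ring.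
rewrite big_split /= exchange_big /=; congr (_ + _)%E.
rewrite sumEFin sumrN; congr (- _)%:E.
(* Since the weights sum to 1, the current price term leaves the expectation unchanged. *)
under eq_bigr do rewrite mulrDr; rewrite big_split /= -mulr_suml p1 mul1r.
by rewrite total_priced_demandS.
Qed.

(** With the demand constraint relaxed, the joint action set is a product, so [is_emin_sum] applies
    to the split objective. *)
Lemma lagr_values_split k t x v : (1 <= t <= T)%N ->
  s_demand x \in demand_set M t ->
  (forall i, regular (demand_set M t.+1) (glagr_togo M lambda i k t.+1)) ->
  (forall x' v', s_demand x' \in demand_set M t.+1 ->
    lagr_togo M lambda k t.+1 x' v' =
    (\sum_(i < n) glagr_togo M lambda i k t.+1 (scomp x' i) v'
     - (total_priced_demand k t.+1 v' (s_demand x'))%:E)%E) ->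
  is_emin (lagr_values M lambda t x v (lagr_togo M lambda k t.+1))
    (\sum_(i < n) glagr_togo M lambda i k.+1 t (scomp x i) v
     - (total_priced_demand k.+1 t v (s_demand x))%:E)%E.
Proof.
move=> tT xD Lr IH; rewrite /lagr_values.
under eq_imagel do rewrite lagr_objective_split //.
apply: (@is_emin_sum _ _ _ (fun i => gaction_set (gens M i) (scomp x i))
  (fun i => glagr_objective M lambda i t (scomp x i) v
              (glagr_togo M lambda i k t.+1))) => [i a|i].
  exact: glagr_objective_neqNy.
exact: glagr_values_min.
Qed.

Lemma lagr_togo_split k t : (0 < t)%N -> (k + t = T.+1)%N ->
  forall x v, s_demand x \in demand_set M t ->
  lagr_togo M lambda k t x v =
  (\sum_(i < n) glagr_togo M lambda i k t (scomp x i) v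
   - (total_priced_demand k t v (s_demand x))%:E)%E.
Proof.
elim: k t => [|k IH] t t0 ktT x v xD.
  by rewrite /= /total_priced_demand big_ord0 big1 // sube0.
have tT : (1 <= t <= T)%N by rewrite t0 /= -ltnS -ktT addSn ltnS leq_addl.
have ktT' : (k + t.+1 = T.+1)%N by rewrite addnS.
apply: is_emin_inf; apply: lagr_values_split => //.
  by move=> i; exact: glagr_togo_regular.
exact: IH.
Qed.

End Decoupling.

(** * Conditional expectations of the priced demand *)

Section FiniteValued.
Variables (R : realType) (d : measure_display) (Omega : measurableType d).
Variable P : probability Omega R.

(** Peels off one value of [Y] at a time; [uniq s] guarantees that the remaining pieces are
    untouched. *)
Lemma Rintegral_partition (Y f : Omega -> R) (s : seq R) (B : set Omega) :
  measurable_fun setT Y -> P.-integrable setT (EFin \o f) -> uniq s ->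
  measurable B -> (forall omega, B omega -> Y omega \in s) ->
  (\int[P]_(omega in B) f omega =
   \sum_(w <- s) \int[P]_(omega in B `&` [set omega | Y omega = w]) f omega)%R.
Proof.
move=> mY intf; have mYw w : measurable [set omega | Y omega = w].
  by have := mY measurableT [set w] (measurable_set1 w); rewrite setTI.
elim: s B => [|w s IH] B us mB BY.
  rewrite big_nil (_ : B = set0) ?Rintegral_set0 //.
  by apply/seteqP; split => // omega /BY.
move: us => /= /andP[ws us].
rewrite big_cons -{1}(setUIDK B [set omega | Y omega = w]).
rewrite Rintegral_setU; last 4 first.
- exact: measurableI.
- exact: measurableD.
- rewrite setUIDK; exact: integrableS intf.
- by rewrite disj_set2E; apply/eqP/seteqP; split => // omega [[_ ?] []].
congr (_ + _); rewrite (IH (B `\` _)) //; last 2 first.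
- exact: measurableD.
- move=> omega [/BY]; rewrite inE => /predU1P[]//.
rewrite big_seq [RHS]big_seq; apply: eq_bigr => w' w's; congr Rintegral.
apply/seteqP; split => omega [] => [[Bo _]|Bo] /= Yw; split => //; split => //.
by move=> Yww; move: ws; rewrite -Yww Yw w's.
Qed.

End FiniteValued.

Section Demand.
Variables (R : realType) (n : nat) (V : choiceType) (M : uc_model R n V).
Variables (d : measure_display) (Omega : measurableType d).
Variables (P : probability Omega R) (D : nat -> {RV P >-> R}).
Hypothesis Dok : demand_process M D.
Local Notation T := (horizon M).

Lemma demand_mem t omega : (1 <= t <= T)%N -> D t omega \in demand_set M t.
Proof. by case: Dok => H _ _ _; exact: H. Qed.

Lemma measurable_demand_eq t w : measurable [set omega | D t omega = w].
Proof. exact: (measurable_funPTI (D t) (measurable_set1 w)). Qed.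

(** * Demand histories and the events they determine *)

Definition extend (h : nat -> R) (t : nat) (w : R) : nat -> R :=
  fun s => if s == t then w else h s.

Lemma history_extend h t w :
  history D (extend h t.+1 w) t.+1 =
  history D h t `&` [set omega | D t.+1 omega = w].
Proof.
apply/seteqP; split => omega.
  move=> H; split => [s /andP[s1 st]|] /=.
    rewrite H ?s1 1?ltnW // /extend ifF //; apply/eqP => sE.
    by rewrite sE ltnn in st.
  by rewrite H ?leqnn // /extend eqxx.
move=> [H /= Dw] s /andP[s1]; rewrite leq_eqVlt => /predU1P[->|st].
  by rewrite /extend eqxx.
rewrite /extend ifF ?H ?s1 //; apply/eqP => sE; by rewrite sE ltnn in st.
Qed.

Lemma summary_eq h h' t : (forall s, (1 <= s <= t)%N -> h s = h' s) ->
  summary M h t = summary M h' t.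
Proof.
elim: t => [|[|t] IH] hh' //=; congr summary_fun; last by apply: hh'; rewrite leqnn.
by apply: IH => s /andP[s1 st]; apply: hh'; rewrite s1 ltnW.
Qed.

Lemma summary_extend h t w : (0 < t)%N ->
  summary M (extend h t.+1 w) t.+1 = summary_fun M t.+1 (summary M h t) w.
Proof.
case: t => // t _ /=; congr summary_fun; last by rewrite /extend eqxx.
apply: (@summary_eq _ _ t.+1) => s /andP[_ st].
by rewrite /extend ifF //; apply/eqP => sE; rewrite sE ltnn in st.
Qed.

Lemma summary_rv_history h t omega : history D h t omega ->
  summary_rv M D t omega = summary M h t.
Proof. by move=> ho; apply: summary_eq. Qed.

Lemma measurable_history h t : measurable (history D h t).
Proof.
elim: t => [|t IH].
  rewrite (_ : history D h 0 = setT) //.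
  by apply/seteqP; split => // omega _ [|s].
rewrite (_ : history D h t.+1 = history D (extend h t.+1 (h t.+1)) t.+1).
  by rewrite history_extend; apply: measurableI => //; exact: measurable_demand_eq.
congr history; apply/funext => s; rewrite /extend; by case: eqP => [->|].
Qed.

(** Refining [A] by one period at a time reduces any property that is inherited from the finitely
    many pieces {D_s = w} to single histories. It serves for measurability, negligibility and
    integral identities alike. *)
Lemma history_ind (Q : set Omega -> Prop) (A : set Omega) t : (t <= T)%N ->
  (forall B s, (1 <= s <= T)%N ->
    (forall w, w \in demand_set M s -> Q (B `&` [set omega | D s omega = w])) ->
    Q B) ->
  (forall h, Q (A `&` history D h t)) -> Q A.
Proof.
move=> tT Qstep; elim: t tT => [|t IH] tT QA.
  have := QA (fun=> 0); rewrite (_ : history _ _ 0 = setT) ?setIT //.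
  by apply/seteqP; split => // omega _ [|s].
apply: (IH (ltnW tT)) => h; apply: (Qstep _ t.+1) => // w _.
by rewrite -setIA -history_extend; exact: QA.
Qed.

Lemma measurable_by_history A t : (t <= T)%N ->
  (forall h, measurable (A `&` history D h t)) -> measurable A.
Proof.
move=> tT; apply: history_ind => // B s sT mB.
rewrite (_ : B = \big[setU/set0]_(w <- demand_set M s)
   (B `&` [set omega | D s omega = w])).
  by rewrite big_seq; apply: big_rec => // w X wD mX; apply: measurableU => //; exact: mB.
rewrite -bigcup_seq; apply/seteqP; split => [omega Bo|omega [w _ []] //].
by exists (D s omega) => //=; exact: demand_mem.
Qed.

Lemma historyP h t omega omega' :
  history D h t omega -> history D h t omega' ->
  forall s, (1 <= s <= t)%N -> D s omega = D s omega'.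
Proof. by move=> ho ho' s sT; rewrite ho // ho'. Qed.

(** Histories are the atoms of the events observable by period [t]. *)
Lemma setI_history A h t :
  (forall omega omega', (forall s, (1 <= s <= t)%N -> D s omega = D s omega') ->
    A omega -> A omega') ->
  A `&` history D h t = set0 \/ history D h t `<=` A.
Proof.
move=> AP; have [[omega [Ao ho]]|A0] := pselect ((A `&` history D h t) !=set0).
  right=> omega' ho'; apply: AP Ao; exact: historyP ho ho'.
by left; apply/seteqP; split => // omega Ao; apply: A0; exists omega.
Qed.

Lemma measurable_observed A t : (t <= T)%N ->
  (forall omega omega', (forall s, (1 <= s <= t)%N -> D s omega = D s omega') ->
    A omega -> A omega') -> measurable A.
Proof.
move=> tT AP; apply: (measurable_by_history tT) => h.
have [->//|hA] := setI_history h AP.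
by rewrite setIC (setIidl hA); exact: measurable_history.
Qed.

(** * Integrals of the priced demand over histories *)

Variable lambda : nat -> V -> R.

Definition price_rv (r : nat) (omega : Omega) : R :=
  lambda r (summary_rv M D r omega) * D r omega.

Lemma price_rv_eq r omega omega' : (0 < r)%N ->
  (forall s, (1 <= s <= r)%N -> D s omega = D s omega') ->
  price_rv r omega = price_rv r omega'.
Proof.
move=> r0 DD; rewrite /price_rv DD ?r0 ?leqnn //; congr (lambda r _ * _).
exact: summary_eq.
Qed.

Lemma integrable_price_rv r : (1 <= r <= T)%N ->
  P.-integrable setT (EFin \o price_rv r).
Proof.
move=> /[dup] rT /andP[r1 rleT].
apply: measurable_bounded_integrable => //.
- by apply: le_lt_trans (probability_le1 P measurableT) _; rewrite ltry.
- move=> _ Y mY; rewrite setTI; apply: (measurable_observed rleT).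
  by move=> omega omega' DD /=; rewrite (price_rv_eq r1 DD).
(* Each factor takes finitely many values, so it is bounded by the sum of their absolute values. *)
pose b := (\sum_(v <- summary_set M r) `|lambda r v|) *
          (\sum_(w <- demand_set M r) `|w|).
exists b; split; first exact: num_real.
move=> x bx omega _; apply: le_trans (ltW bx); rewrite /price_rv normrM.
have vin : summary_rv M D r omega \in summary_set M r by case: Dok => _ _ _; apply.
have win := demand_mem omega rT.
apply: ler_pM => //.
  by rewrite (big_fsetD1 _ vin) /= lerDl; apply: sumr_ge0.
by rewrite (big_fsetD1 _ win) /= lerDl; apply: sumr_ge0.
Qed.

Lemma fine_prob_gt0 (A : set Omega) : measurable A ->
  (0 < P A)%E -> 0 < fine (P A).
Proof. by move=> mA PA; rewrite fine_gt0 // PA ltey_eq fin_num_measure. Qed.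

(** On a history of positive probability this is the Markov property combined with the meaning of
    [trans]; on a null history both sides vanish. *)
Lemma prob_history_extend h t w : (1 <= t < T)%N -> w \in demand_set M t.+1 ->
  fine (P (history D (extend h t.+1 w) t.+1)) =
  trans M t (h t) w * fine (P (history D h t)).
Proof.
move=> tT wD; have mh := measurable_history h t; have mw := measurable_demand_eq t.+1 w.
rewrite history_extend.
have [h0|hpos] := leP (P (history D h t)) 0%E.
  have P0 : P (history D h t) = 0%E by apply/eqP; rewrite eq_le h0 measure_ge0.
  rewrite P0 mulr0 (_ : P _ = 0%E) //.
  apply/eqP; rewrite eq_le measure_ge0 andbT -P0.
  by apply: le_measure; rewrite ?inE //; exact: measurableI.
have hsub : history D h t `<=` [set omega | D t omega = h t].
  by move=> omega /(_ t); case/andP: tT => -> _; rewrite leqnn; apply.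
have epos : (0 < P [set omega | D t omega = h t])%E.
  apply: lt_le_trans hpos _.
  by apply: le_measure; rewrite ?inE //; exact: measurable_demand_eq.
case: Dok => _ Markov transE _.
rewrite transE // -Markov // /cond_prob setIC mulrVK // unitfE.
by rewrite gt_eqF // fine_prob_gt0.
Qed.

(** Splitting the history by the next demand produces one transition factor per outcome, which is
    the recursion of [priced_demand]. *)
Lemma Rintegral_price_history k h t : (0 < t)%N -> (t + k <= T)%N ->
  \int[P]_(omega in history D h t) price_rv (t + k) omega =
  priced_demand M lambda k t (summary M h t) (h t) * fine (P (history D h t)).
Proof.
elim: k h t => [|k IH] h t t0 tkT.
  rewrite addn0 /= -Rintegral_cst; last exact: measurable_history.
  apply: eq_Rintegral => omega; rewrite inE => ho.
  by rewrite /price_rv (summary_rv_history ho) ho // t0 leqnn.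
have tT : (1 <= t < T)%N.
  by rewrite t0 /=; apply: leq_trans tkT; rewrite addnS ltnS leq_addr.
rewrite (@Rintegral_partition _ _ _ _ (D t.+1) _ (demand_set M t.+1)) //; last 4 first.
- by apply: integrable_price_rv; rewrite tkT addn_gt0 t0.
- exact: fset_uniq.
- exact: measurable_history.
- by move=> omega _; apply: demand_mem; case/andP: tT.
rewrite /= mulr_suml big_seq [RHS]big_seq; apply: eq_bigr => w wD.
rewrite -history_extend addnS -addSn IH //; last by rewrite addSn -addnS.
rewrite summary_extend // prob_history_extend // {1}/extend eqxx.
by rewrite mulrCA mulrA.
Qed.

(** * Consistent pairs and conditioning on the summary state *)

Lemma measurable_summary t v : (t <= T)%N ->
  measurable [set omega | summary_rv M D t omega = v].
Proof.
move=> tT; apply: (measurable_observed tT) => omega omega' DD /= <-.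
by apply: summary_eq => s /DD.
Qed.

Lemma consistentE t e v : (1 <= t <= T)%N -> consistent M D t e v <->
  exists h, [/\ (0 < P (history D h t))%E, h t = e & summary M h t = v].
Proof.
move=> /andP[t1 tT]; set A := [set omega | D t omega = e /\ summary_rv M D t omega = v].
have mA : measurable A.
  apply: measurableI; first exact: measurable_demand_eq.
  exact: measurable_summary.
split=> [cons|[h [hpos he hv]]]; last first.
  apply: lt_le_trans hpos _; apply: le_measure; rewrite ?inE //.
    exact: measurable_history.
  move=> omega ho; split; first by rewrite ho ?t1 ?leqnn.
  by rewrite (summary_rv_history ho).
apply: contrapT => noh.
suff : P A = 0%E by apply/eqP; rewrite gt_eqF.
suff : P.-negligible A by move/negligibleP; apply.
(* If no history of positive probability realizes the pair, each history meeting [A] is null, hence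
   so is [A], a finite union of such pieces. *)
apply: (history_ind tT) => [B s sT BN|h].
  rewrite (_ : B = \big[setU/set0]_(w <- demand_set M s)
    (B `&` [set omega | D s omega = w])).
    rewrite big_seq; apply: big_rec => [|w X wD mX]; first exact: negligible_set0.
    by apply: negligibleU => //; exact: BN.
  rewrite -bigcup_seq; apply/seteqP; split => [omega Bo|omega [w _ []] //].
  by exists (D s omega) => //=; exact: demand_mem.
have [[omega [[De vE] ho]]|A0] := pselect ((A `&` history D h t) !=set0); last first.
  rewrite (_ : _ `&` _ = set0); first exact: negligible_set0.
  by apply/seteqP; split => // omega Ao; apply: A0; exists omega.
apply: (negligibleS (@subIsetr _ _ _)); apply/negligibleP.
  exact: measurable_history.
apply/eqP; rewrite eq_le measure_ge0 andbT leNgt; apply/negP => hpos.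
apply: noh; exists h; split => //; first by rewrite -De ho ?t1 ?leqnn.
by rewrite -(summary_rv_history ho).
Qed.

Hypothesis Vok : summary_sufficient M D.

(** Only the first transition can see the current demand, and its law depends on [v] alone by the
    standing assumption with r = t + 1. At least one step is required: for r = t the value is the
    price times the current demand itself. *)
Lemma priced_demand_summary k t v e e' : (0 < t)%N -> (t + k.+1 <= T)%N ->
  consistent M D t e v -> consistent M D t e' v ->
  priced_demand M lambda k.+1 t v e = priced_demand M lambda k.+1 t v e'.
Proof.
move=> t0 tkT; have tT : (t < T)%N.
  by apply: leq_trans tkT; rewrite addnS ltnS leq_addr.
have tT' : (1 <= t <= T)%N by rewrite t0 ltnW.
move=> /(consistentE _ _ tT')[h [hpos <- hv]].
move=> /(consistentE _ _ tT')[h' [h'pos <- h'v]].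
rewrite /= big_seq [RHS]big_seq; apply: eq_bigr => w wD; congr (_ * _).
have pos0 g : (0 < P (history D g t))%E -> 0 < fine (P (history D g t)).
  by apply: fine_prob_gt0; exact: measurable_history.
have transE g : (0 < P (history D g t))%E -> trans M t (g t) w =
    cond_prob P [set omega | D t.+1 omega = w] (history D g t).
  move=> gpos; rewrite /cond_prob setIC -history_extend.
  by rewrite prob_history_extend ?t0 // mulfK // gt_eqF // pos0.
by rewrite !transE //; apply: Vok; rewrite ?t0 ?leqnn ?hv.
Qed.

(** For a later period, every history of positive probability inside {v_t = v} contributes the same
    value [c] times its probability, so the conditional average is [c]. *)
Lemma expected_priced_demandE k t v e : (0 < t)%N -> (t + k <= T)%N ->
  consistent M D t e v ->
  expected_priced_demand M D lambda t (t + k) v e =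
  priced_demand M lambda k t v e.
Proof.
case: k => [|k] t0 tkT cons; rewrite /expected_priced_demand.
  by rewrite addn0 eqxx.
rewrite ifF; last by apply/eqP => tE; move: (leq_addr k t); rewrite -ltnS -addnS tE ltnn.
have tT : (t <= T)%N by apply: leq_trans tkT; exact: leq_addr.
set B := [set omega | summary_rv M D t omega = v].
have mB : measurable B by exact: measurable_summary.
have Bpos : 0 < fine (P B).
  apply: fine_prob_gt0 => //; apply: lt_le_trans cons _.
  apply: le_measure; rewrite ?inE //; last by move=> omega [].
  by apply: measurableI => //; exact: measurable_demand_eq.
suff : \int[P]_(omega in B) price_rv (t + k.+1) omega =
    priced_demand M lambda k.+1 t v e * fine (P B).
  by rewrite /cond_expect => ->; rewrite mulfK // gt_eqF.
set c := priced_demand _ _ _ _ _ _.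
(* Measurability is a premise inside [Q] because [history_ind] supplies arbitrary sets. *)
pose Q A := measurable A ->
  \int[P]_(omega in A) price_rv (t + k.+1) omega = c * fine (P A).
have tkT' : (1 <= t + k.+1 <= T)%N by rewrite tkT addn_gt0 t0.
apply: (@history_ind Q _ t) => // [A s sT QA mA|h _].
  (* The probability is written as the integral of 1 so that the same partition lemma splits both
     sides. *)
  rewrite -[fine (P A)]mul1r -Rintegral_cst //.
  rewrite (@Rintegral_partition _ _ _ _ (D s) _ (demand_set M s)) //; last 3 first.
  - exact: integrable_price_rv.
  - exact: fset_uniq.
  - by move=> omega _; exact: demand_mem.
  rewrite [X in c * X](@Rintegral_partition _ _ _ _ (D s) _ (demand_set M s)) //; last 3 first.
  - exact: finite_measure_integrable_cst.
  - exact: fset_uniq.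
  - by move=> omega _; exact: demand_mem.
  rewrite mulr_sumr big_seq [RHS]big_seq; apply: eq_bigr => w wD.
  have mAw : measurable (A `&` [set omega | D s omega = w]).
    by apply: measurableI => //; exact: measurable_demand_eq.
  by rewrite QA // Rintegral_cst // mul1r.
have [[omega [Bo ho]]|B0] := pselect ((B `&` history D h t) !=set0); last first.
  rewrite (_ : B `&` _ = set0) ?Rintegral_set0 ?measure0 ?mulr0 //.
  by apply/seteqP; split => // omega Bo; apply: B0; exists omega.
have hv : summary M h t = v by rewrite -(summary_rv_history ho).
have -> : B `&` history D h t = history D h t.
  by apply: setIidr => omega' ho'; rewrite /B /= (summary_rv_history ho').
rewrite Rintegral_price_history // hv.
(* The comparison with [c] needs a history of positive probability; a null one contributes 0 to both
   sides. *)
have [h0|hpos] := leP (P (history D h t)) 0%E.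
  have -> : P (history D h t) = 0%E by apply/eqP; rewrite eq_le h0 measure_ge0.
  by rewrite !mulr0.
congr (_ * _); apply: priced_demand_summary => //.
by apply/consistentE; [rewrite t0|exists h].
Qed.

End Demand.

Theorem theorem3 (R : realType) (n : nat) (V : choiceType) (M : uc_model R n V)
    (d : measure_display) (Omega : measurableType d) (P : probability Omega R)
    (D : nat -> {RV P >-> R}) :
  model_ok M -> demand_process M D -> summary_sufficient M D ->
  forall (lambda : nat -> V -> R) (t : nat) (x : sstate R n) (v : V),
    (1 <= t <= horizon M)%N ->
    sstate_set M t x ->
    consistent M D t (s_demand x) v ->
    [/\ is_emin (lagr_values M lambda t x v (lagr M lambda t.+1))
                (lagr M lambda t x v),
        forall i : 'I_n,
          is_emin (glagr_values M lambda i t (scomp x i) v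
                     (glagr M lambda i t.+1))
                  (glagr M lambda i t (scomp x i) v)
      & lagr M lambda t x v =
        (\sum_(i < n) glagr M lambda i t (scomp x i) v
         - (\sum_(t <= r < (horizon M).+1)
              expected_priced_demand M D lambda t r v (s_demand x))%R%:E)%E].
Proof.
move=> Mok Dok Vok lambda t x v tT [_ xD] cons.
have [t0 tleT] := andP tT.
pose k := (horizon M - t)%N.
have kt : (k + t = horizon M)%N by rewrite subnK.
have kSE : ((horizon M).+1 - t = k.+1)%N by rewrite subSn.
have kSt : (k.+1 + t = (horizon M).+1)%N by rewrite addSn kt.
have ktS : (k + t.+1 = (horizon M).+1)%N by rewrite addnS kt.
have Lr i : regular (demand_set M t.+1) (glagr_togo M lambda i k t.+1).
  exact: glagr_togo_regular.
have lagrE := lagr_togo_split Mok lambda t0 kSt v xD.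
rewrite /lagr /glagr kSE subSS -/k; split.
- rewrite lagrE; apply: lagr_values_split => // x' v' x'D.
  exact: lagr_togo_split.
- by move=> i; exact: glagr_values_min.
rewrite lagrE; congr (_ - _%:E)%E.
(* Reindexes the demand sum by r = t + j with j at most T - t, matching [total_priced_demand]. *)
rewrite -[X in \sum_(X <= _ < _) _]add0n big_addn kSE big_mkord; apply: eq_bigr => j _.
rewrite addnC expected_priced_demandE //.
by rewrite -kt addnC leq_add2r -ltnS.
Qed.
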